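(* Let $M$ be a finite set, let $K$ be a nonempty subposet of $2^M$, and let $N$ be a finite set. Consider maps $f:N\to K$ and $g:N\to\overline{K}$. Then the following conditions are equivalent: (a) For every order ideal $J$ of $K$, $\displaystyle\sum_{T\in J}|f^{-1}(T)|\le\sum_{T\in J}|g^{-1}(T^C)|$. (b) For every order ideal $I$ of $\overline{K}$, $\displaystyle\sum_{S\in I}|g^{-1}(S)|\le\sum_{S\in I}|f^{-1}(S^C)|$. (c) There exists a permutation $\sigma\in\operatorname{Sym}(N)$ such that $f(i)\cap g(\sigma(i))=\varnothing$ for every $i\in N$.
   Context: $2^M$ is the Boolean lattice of subsets of $M$ ordered by inclusion. A subposet $K$ of $2^M$ is a subset with the induced order. For $T\subseteq M$, $T^C:=M-T$, and for $J\subseteq 2^M$, $\overline{J}:=\{T^C\mid T\in J\}$ (the set of complements of elements of $J$, not the complement of $J$). A subset $J\subseteq K$ is an (upper) order ideal of $K$ if $T\in J$, $S\in K$ and $S\supseteq T$ imply $S\in J$. $\operatorname{Sym}(N)$ is the group of permutations of $N$. *)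

(* Defs.v *)
From mathcomp Require Import all_boot.

Set Implicit Arguments.
Unset Strict Implicit.
Unset Printing Implicit Defensive.

(* The family of complements of the members of J, not the complement ~: J. *)
Definition compl_family (M : finType) (J : {set {set M}}) : {set {set M}} :=
  [set ~: T | T in J].

(* Ideals are upward closed: "order ideal" means upper order ideal of K. *)
Definition order_ideal (M : finType) (K J : {set {set M}}) : Prop :=
  J \subset K /\
  (forall T S : {set M}, T \in J -> S \in K -> T \subset S -> S \in J).

(* Main.v *)
(** Put [j] next to [i] when [f i] and [g j] are disjoint; (c) asks for a perfect
    matching. The points outside the neighbourhood of a set [X] of indices are
    the preimage under [g] of an upper order ideal of complements, so (b)
    contains Hall's condition. Conditions (a) and (b) are exchanged by passing
    from an ideal to the complements of the members of [K] outside it, and a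
    matching injects the preimage of an ideal under [f] into the one under the
    complement of [g]. *)

Require Import Defs.
From mathcomp Require Import all_boot all_fingroup.

Section Hall.

Set Implicit Arguments.
Unset Strict Implicit.

Variables T U : finType.
Implicit Types (r : T -> {set U}) (X : {set T}).

Definition hall r := forall X, #|X| <= #|\bigcup_(x in X) r x|.

Definition remove_edge r x y : T -> {set U} :=
  fun z => if z == x then r x :\ y else r z.

(** Deleting the edge only affects neighbourhoods of sets containing [x], so a violating set
    contains [x]. The witness is that set without [x]; the strict violation absorbs the lost
    point. *)
Lemma hall_violation r x y (hr : hall r) :
  ~~ [forall X : {set T}, #|X| <= #|\bigcup_(z in X) remove_edge r x y z|] ->
  exists X, x \notin X /\ #|(\bigcup_(z in X) r z) :|: (r x :\ y)| <= #|X|.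
Proof.
case/forallPn=> X; rewrite -ltnNge => ltX.
have rem_r Y : x \notin Y ->
    \bigcup_(z in Y) remove_edge r x y z = \bigcup_(z in Y) r z.
  move=> xY; apply: eq_bigr => z zY; rewrite /remove_edge.
  by case: eqP => // zx; rewrite -zx zY in xY.
have xX : x \in X.
  by apply: contraLR ltX => xX; rewrite rem_r // -leqNgt hr.
exists (X :\ x); rewrite !inE eqxx; split=> //.
move: ltX; rewrite (cardsD1 x X) xX add1n ltnS (big_setD1 x) //=.
by rewrite rem_r ?inE ?eqxx // {1}/remove_edge eqxx setUC.
Qed.

(* Rado's argument: if deleting either of two edges at [x] broke Hall's
   condition, submodularity of the neighbourhood size applied to the two
   violating sets would contradict it. *)
Lemma hall_remove_edge r x (hr : hall r) :
  1 < #|r x| -> exists2 y, y \in r x & hall (remove_edge r x y).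
Proof.
case/card_gt1P=> y1 [y2] [y1r y2r y12].
have [/forallP h1|/(hall_violation hr) [X1 [x1 le1]]] := boolP
  [forall X : {set T}, #|X| <= #|\bigcup_(z in X) remove_edge r x y1 z|].
  by exists y1.
have [/forallP h2|/(hall_violation hr) [X2 [x2 le2]]] := boolP
  [forall X : {set T}, #|X| <= #|\bigcup_(z in X) remove_edge r x y2 z|].
  by exists y2.
(* As [x] lies in neither set, the left side is [#|X1| + #|X2| + 1], a contradiction. *)
suff: #|x |: (X1 :|: X2)| + #|X1 :&: X2| <= #|X1| + #|X2|.
  by rewrite cardsU1 !inE negb_or x1 x2 -addnA cardsUI add1n ltnn.
apply: leq_trans (leq_add le1 le2); rewrite -[leqRHS]cardsUI.
apply: leq_add; (apply: leq_trans (hr _) _; apply: subset_leq_card).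
  apply/bigcupsP=> z; rewrite !inE => /or3P [/eqP->|zX1|zX2]; apply/subsetP=> u uz.
  (* As [y1 != y2], the sets [r x :\ y1] and [r x :\ y2] together cover [r x]. *)
  - by rewrite !inE uz; case: (eqVneq u y1) => [->|_]; rewrite ?y12 ?orbT.
  - have uX1 : u \in \bigcup_(z in X1) r z by apply/bigcupP; exists z.
    by rewrite !inE uX1.
  - have uX2 : u \in \bigcup_(z in X2) r z by apply/bigcupP; exists z.
    by rewrite !inE uX2 orbT.
apply/bigcupsP=> z; rewrite inE => /andP [z1 z2]; apply/subsetP=> u uz.
by rewrite !inE; apply/andP; split; apply/orP; left; apply/bigcupP; exists z.
Qed.

(** Induction on the number of edges, deleting one while some point has two neighbours. Once all
    degrees are at most one, Hall's condition on singletons gives exactly one neighbour, and on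
    pairs gives injectivity. *)
Theorem hall_marriage r (hr : hall r) :
  exists2 h : T -> U, injective h & forall x, h x \in r x.
Proof.
have [n] := ubnP (\sum_x #|r x|); elim: n r hr => // n IHn r hr len.
have [x gt1|le1] := pickP (fun x => 1 < #|r x|).
  have [y yr hr'] := hall_remove_edge hr gt1.
  have sub z : remove_edge r x y z \subset r z.
    by rewrite /remove_edge; case: eqP => [->|_ //]; apply: subsetDl.
  have [|h hinj hP] := IHn _ hr'.
    rewrite -ltnS; apply: leq_trans len; rewrite ltnS (bigD1 x) //= [leqRHS](bigD1 x) //=.
    rewrite -addSn leq_add // ?leq_sum // => [|z _]; last exact: subset_leq_card.
    by rewrite /remove_edge eqxx (cardsD1 y (r x)) yr.
  by exists h => // z; apply: (subsetP (sub z)).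
have [x|h hP] := @fin_all_exists T (fun=> U) (fun x y => r x = [set y]).
  apply/cards1P; rewrite eqn_leq leqNgt le1 /=.
  by have := hr [set x]; rewrite cards1 big_set1.
exists h => [x z hxz|x]; last by rewrite hP set11.
apply/eqP; apply: contraT => xz; have := hr [set x; z].
by rewrite cards2 xz big_setU1 ?inE //= big_set1 !hP hxz setUid cards1.
Qed.

End Hall.

Lemma sum_card_preimset1 (N U : finType) (f : N -> U) (J : {set U}) :
  \sum_(T in J) #|f @^-1: [set T]| = #|f @^-1: J|.
Proof.
rewrite -sum1_card (partition_big f (mem J)) /= => [|i]; last by rewrite inE.
apply: eq_bigr => T TJ; rewrite -sum1_card; apply: eq_bigl => i.
by rewrite !inE andbC; case: eqP => // ->.
Qed.

Lemma sum_card_preimsetC1 (N M : finType) (f : N -> {set M}) (J : {set {set M}}) :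
  \sum_(T in J) #|f @^-1: [set ~: T]| = #|[set i | ~: f i \in J]|.
Proof.
transitivity #|(fun i => ~: f i) @^-1: J|; last by [].
rewrite -sum_card_preimset1; apply: eq_bigr => T _.
by apply: eq_card => i; rewrite !inE (can2_eq setCK setCK).
Qed.

Lemma mem_compl_family (M : finType) (K : {set {set M}}) (T : {set M}) :
  (T \in compl_family K) = (~: T \in K).
Proof. by rewrite -{1}[T]setCK mem_imset //; apply: setC_inj. Qed.

Theorem theorem2p7 (M : finType) (K : {set {set M}}) (hK : K != set0)
    (N : finType) (f g : N -> {set M})
    (hf : forall i : N, f i \in K)
    (hg : forall i : N, g i \in compl_family K) :
  [<->
    (* (a) *)
    forall J : {set {set M}}, order_ideal K J ->
      \sum_(T in J) #|f @^-1: [set T]| <= \sum_(T in J) #|g @^-1: [set ~: T]|;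
    (* (b) *)
    forall I : {set {set M}}, order_ideal (compl_family K) I ->
      \sum_(S in I) #|g @^-1: [set S]| <= \sum_(S in I) #|f @^-1: [set ~: S]|;
    (* (c) *)
    exists sigma : {perm N}, forall i : N, f i :&: g (sigma i) = set0].
Proof.
have hgC i : ~: g i \in K by rewrite -mem_compl_family.
tfae=> [ha I [_ upI]|hb|[s sP] J [_ upJ]].
- have /ha : order_ideal K [set T in K | ~: T \notin I].
    split=> [|T S]; first by apply/subsetP=> T; rewrite inE => /andP [].
    rewrite !inE => /andP [TK TI] SK TS; rewrite SK; apply: contra TI => SI.
    by apply: upI SI _ _; rewrite ?mem_compl_family ?setCK ?setCS.
  rewrite !sum_card_preimset1 !sum_card_preimsetC1 => le_fg.
  (* Both cardinalities are traded for those of the complements in [N], which reverses the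
     inequality to match [le_fg]. *)
  rewrite -(leq_add2r #|~: [set i | ~: f i \in I]|) cardsC.
  rewrite -[leqLHS]addnC -(cardsC (g @^-1: I)) addnC leq_add2l.
  have -> : ~: [set i | ~: f i \in I] = f @^-1: [set T in K | ~: T \notin I].
    by apply/setP=> i; rewrite !inE hf.
  apply: leq_trans le_fg _; apply: subset_leq_card; apply/subsetP=> i.
  by rewrite !inE setCK => /andP [].
- pose r i := [set j | f i \subset ~: g j].
  have [X|h hinj hP] := @hall_marriage _ _ r.
    (* [g j] lies in [I] exactly when [j] is outside the neighbourhood of [X]. *)
    pose I := [set S in compl_family K | [forall i in X, ~~ (f i \subset ~: S)]].
    have /hb : order_ideal (compl_family K) I.
      split=> [|S S']; first by apply/subsetP=> S; rewrite inE => /andP [].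
      rewrite !inE => /andP [_ /forall_inP noS] S'K SS'; rewrite S'K.
      apply/forall_inP=> i iX; apply: contra (noS i iX) => fS'.
      by apply: subset_trans fS' _; rewrite setCS.
    rewrite sum_card_preimset1 sum_card_preimsetC1 => le_gf.
    rewrite -(leq_add2r #|~: X|) cardsC -(cardsC (\bigcup_(i in X) r i)) leq_add2l.
    apply: leq_trans (leq_trans le_gf _); apply: subset_leq_card; apply/subsetP=> j.
      rewrite !inE hg => /bigcupP njX; apply/forall_inP=> i iX.
      by apply/negP=> fg; apply: njX; exists i; rewrite // inE.
    (* No [i] in [X] has [~: f i] in [I], because [f i] is contained in itself. *)
    rewrite !inE setCK => /andP [_ /forall_inP njX].
    by apply/negP=> /njX; rewrite subxx.
  exists (perm hinj) => i; rewrite permE; apply/eqP.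
  by have := hP i; rewrite inE -disjoints_subset setI_eq0.
- rewrite sum_card_preimset1 sum_card_preimsetC1 -(card_imset _ (@perm_inj _ s)).
  apply: subset_leq_card; apply/subsetP=> _ /imsetP [i fiJ ->].
  (* Disjointness reads [f i \subset ~: g (s i)], so upward closure of [J] applies. *)
  rewrite !inE in fiJ *; apply: upJ fiJ (hgC _) _.
  by rewrite -disjoints_subset -setI_eq0 sP.
Qed.
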